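(* Let $(M,d)$ be a complete pointed metric space with base point $0$. For any $\phi\in\mathrm{Lip}_0(M)^*$ we have $$\sum_{n\in\mathbb{Z}}\|\phi\circ T_{\Lambda_n}\|\leq 45\|\phi\|.$$ Hence $$\sum_{k=-n}^n\phi\circ T_{\Lambda_k}=\phi\circ T_{\Pi_n}$$ converges in norm as $n\to\infty$ to a functional in $\mathrm{Lip}_0(M)^*$.
   Context: $\mathrm{Lip}_0(M)$ is the Banach space of all real-valued Lipschitz functions $f$ on $M$ with $f(0)=0$, with norm $\|f\|_L=\sup\{|f(x)-f(y)|/d(x,y): x\neq y\in M\}$, and $\mathrm{Lip}_0(M)^*$ is its dual Banach space with the dual norm. For a real-valued Lipschitz function $h$ on $M$ whose support $\{x\in M:h(x)\neq 0\}$ is bounded, $T_h:\mathrm{Lip}_0(M)\to\mathrm{Lip}_0(M)$ is the bounded linear operator $T_h(f)=f\cdot h$ (pointwise product). For $n\in\mathbb{Z}$, $\Lambda_n:M\to\mathbb{R}$ is defined by $$\Lambda_n(x)=\begin{cases}0&\text{if } d(x,0)\le 2^{n-1}\\ 2^{-(n-1)}d(x,0)-1&\text{if } 2^{n-1}\le d(x,0)\le 2^n\\ 2-2^{-n}d(x,0)&\text{if } 2^n\le d(x,0)\le 2^{n+1}\\ 0&\text{if } 2^{n+1}\le d(x,0).\end{cases}$$ For $n\in\mathbb{N}$, $\Pi_n:M\to\mathbb{R}$ is defined by $$\Pi_n(x)=\begin{cases}0&\text{if } d(x,0)\le 2^{-(n+1)}\\ 2^{n+1}d(x,0)-1&\text{if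 } 2^{-(n+1)}\le d(x,0)\le 2^{-n}\\ 1&\text{if } 2^{-n}\le d(x,0)\le 2^n\\ 2-2^{-n}d(x,0)&\text{if } 2^n\le d(x,0)\le 2^{n+1}\\ 0&\text{if } 2^{n+1}\le d(x,0).\end{cases}$$ These are Lipschitz functions with bounded support. *)

(* Defs.v *)
From HB Require Import structures.
From mathcomp Require Import all_boot all_order all_algebra.
From mathcomp Require Import ring lra.
From mathcomp Require Import all_classical all_reals all_analysis.

Set Implicit Arguments.
Unset Strict Implicit.
Unset Printing Implicit Defensive.

Import Order.TTheory GRing.Theory Num.Theory.
Import numFieldNormedType.Exports.

Local Open Scope classical_set_scope.
Local Open Scope ring_scope.

(* The base point, written 0 in the literature, is the [point] of the
   pointedType structure. *)
#[short(type="pointedMetricType")]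
HB.structure Definition PointedMetric (K : numDomainType) :=
  {M of Metric K M & isPointed M}.

#[short(type="completePointedMetricType")]
HB.structure Definition CompletePointedMetric (K : numDomainType) :=
  {M of Metric K M & Complete M}.

Lemma seminorm_homog (R : realType) (V : lmodType R) (N : V -> R) :
  (forall x, 0 <= N x) -> (forall l x, N (l *: x) <= `|l| * N x) ->
  forall l x, N (l *: x) = `|l| * N x.
Proof.
move=> N0 NZ l x; apply/eqP; rewrite eq_le NZ/=.
have [->|l0] := eqVneq l 0; first by rewrite normr0 mul0r.
have := NZ l^-1 (l *: x); rewrite scalerA mulVf// scale1r normfV.
by rewrite mulrC ler_pdivlMr ?normr_gt0// mulrC.
Qed.

Section Lipschitz.
Context {R : realType} {M : metricType R}.

Definition is_lipschitz (f : M -> R) :=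
  exists L : R, forall x y, `|f x - f y| <= L * mdist x y.

Definition has_bounded_support (f : M -> R) :=
  exists (c : M) (r : R), forall x, f x != 0 -> mdist x c <= r.

Lemma is_lipschitz_ge0 (f : M -> R) : is_lipschitz f ->
  exists2 L : R, 0 <= L & forall x y, `|f x - f y| <= L * mdist x y.
Proof.
move=> [L Lf]; exists `|L|; first exact: normr_ge0.
by move=> x y; rewrite (le_trans (Lf x y))// ler_wpM2r ?mdist_ge0 ?ler_norm.
Qed.

End Lipschitz.

Section LipBS.
Context {R : realType} (M : metricType R).

(* Lipschitz functions with bounded support; unlike for Lip0, no value is
   prescribed at a base point. *)
Record lip_bs := LipBS {
  lip_bs_fun :> M -> R ;
  lip_bs_lipschitz : is_lipschitz lip_bs_fun ;
  lip_bs_support : has_bounded_support lip_bs_fun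
}.

End LipBS.

Section Lip0.
Context {R : realType} (M : pointedMetricType R).

Definition lip0_pred : {pred (M -> R)} :=
  [pred f | `[< is_lipschitz f /\ f point = 0 >]].

Record Lip0 := mkLip0 { Lip0_fun :> M -> R ; _ : Lip0_fun \in lip0_pred }.

HB.instance Definition _ := [isSub for Lip0_fun].
HB.instance Definition _ := [Choice of Lip0 by <:].

Lemma lip0_submod_closed : submod_closed lip0_pred.
Proof.
split=> [|a f g].
  apply/asboolP; split=> //; exists 0 => x y.
  by rewrite /= subrr normr0 mul0r.
move=> /asboolP[/is_lipschitz_ge0[K K0 Kf] f0].
move=> /asboolP[/is_lipschitz_ge0[L L0 Lg] g0].
apply/asboolP; split; last by rewrite !fctE f0 g0 scaler0 addr0.
exists (`|a| * K + L) => x y.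
have -> : (a *: f + g) x - (a *: f + g) y = a * (f x - f y) + (g x - g y).
  by rewrite !fctE /GRing.scale/=; ring.
rewrite mulrDl (le_trans (ler_normD _ _))// lerD// normrM -mulrA.
by rewrite ler_wpM2l.
Qed.

HB.instance Definition _ := GRing.isSubmodClosed.Build _ _ lip0_pred
  lip0_submod_closed.
HB.instance Definition _ := [SubChoice_isSubLmodule of Lip0 by <:].

Implicit Types f g : Lip0.

Lemma Lip0_lipschitz f : is_lipschitz f.
Proof. by case: f => f /= /asboolP[]. Qed.

Lemma Lip0_point f : f point = 0.
Proof. by case: f => f /= /asboolP[]. Qed.

(* The supremum is over the empty set, hence 0, when M is a singleton. *)
Definition lip_norm f : R :=
  sup [set `|f z.1 - f z.2| / mdist z.1 z.2 | z in [set z | z.1 != z.2]].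

Lemma lip_norm_le f (C : R) : 0 <= C ->
  (forall x y, `|f x - f y| <= C * mdist x y) -> lip_norm f <= C.
Proof.
move=> C0 Cf; rewrite /lip_norm; set A := (X in sup X).
have [->|A0] := eqVneq A set0; first by rewrite sup0.
apply: ge_sup; first exact/set0P.
by move=> _ [[x y] /= xy <-]; rewrite ler_pdivrMr ?mdist_gt0.
Qed.

Lemma lip_normP f x y : `|f x - f y| <= lip_norm f * mdist x y.
Proof.
have [->|xy] := eqVneq x y; first by rewrite subrr normr0 mdistxx mulr0.
rewrite -ler_pdivrMr ?mdist_gt0//; apply: ub_le_sup; last by exists (x, y).
have [L _ Lf] := is_lipschitz_ge0 (Lip0_lipschitz f).
by exists L => _ [[u v] /= uv <-]; rewrite ler_pdivrMr ?mdist_gt0.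
Qed.

Lemma lip_norm_ge0 f : 0 <= lip_norm f.
Proof.
rewrite /lip_norm; set A := (X in sup X).
have [->|/set0P[_ [[x y] /= xy _]]] := eqVneq A set0; first by rewrite sup0.
have := le_trans (normr_ge0 _) (lip_normP f x y).
by rewrite pmulr_lge0// mdist_gt0.
Qed.

Lemma lip_normD f g : lip_norm (f + g) <= lip_norm f + lip_norm g.
Proof.
apply: lip_norm_le => [|x y]; first by rewrite addr_ge0 ?lip_norm_ge0.
have -> : (f + g) x - (f + g) y = (f x - f y) + (g x - g y).
  by rewrite /= !fctE; ring.
by rewrite mulrDl (le_trans (ler_normD _ _))// lerD// lip_normP.
Qed.

Lemma lip_normZ (l : R) f : lip_norm (l *: f) = `|l| * lip_norm f.
Proof.
apply: seminorm_homog => [|{}l {}f]; first exact: lip_norm_ge0.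
apply: lip_norm_le => [|x y]; first by rewrite mulr_ge0 ?lip_norm_ge0.
have -> : (l *: f) x - (l *: f) y = l * (f x - f y).
  by rewrite /= !fctE /GRing.scale/=; ring.
by rewrite normrM -mulrA ler_wpM2l// lip_normP.
Qed.

Lemma lip_norm_eq0 f : lip_norm f = 0 -> f = 0.
Proof.
move=> f0; apply/val_inj/funext => x /=.
have := lip_normP f x point; rewrite f0 mul0r Lip0_point subr0 normr_le0.
by move/eqP.
Qed.

HB.instance Definition _ :=
  @Lmodule_isNormed.Build R Lip0 lip_norm lip_normD lip_normZ lip_norm_eq0.

End Lip0.
Arguments lip0_pred {R} M _.

Section Dual.
Context {R : realType} (V : normedModType R).

Definition dual_pred : {pred (V -> R)} :=
  [pred phi : V -> R | `[< scalar phi /\ continuous phi >]].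

Record dual := mkDual { dual_fun :> V -> R ; _ : dual_fun \in dual_pred }.

HB.instance Definition _ := [isSub for dual_fun].
HB.instance Definition _ := [Choice of dual by <:].

Lemma dual_submod_closed : submod_closed dual_pred.
Proof.
split=> [|a phi psi].
  apply/asboolP; split=> [b u v|].
    by rewrite -[RHS]/(b * 0 + 0) mulr0 addr0.
  exact: cst_continuous.
move=> /asboolP[lphi cphi] /asboolP[lpsi cpsi].
apply/asboolP; split=> [b u v|u].
  by rewrite !fctE lphi lpsi /GRing.scale/=; ring.
by apply: (@continuousD R R V); [apply: (@continuousZr R R V); exact: cphi
  |exact: cpsi].
Qed.

HB.instance Definition _ := GRing.isSubmodClosed.Build _ _ dual_pred
  dual_submod_closed.
HB.instance Definition _ := [SubChoice_isSubLmodule of dual by <:].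

Implicit Types phi psi : dual.

Lemma dual_scalar phi : scalar phi.
Proof. by case: phi => phi /= /asboolP[]. Qed.

Lemma dual_continuous phi : continuous phi.
Proof. by case: phi => phi /= /asboolP[]. Qed.

HB.instance Definition _ phi :=
  GRing.isLinear.Build R V R *%R (phi : V -> R) (dual_scalar phi).

Definition dual_norm phi : R :=
  sup [set `|phi f| | f in [set f | `|f| <= 1]].


Lemma dual_bounded phi :
  exists2 C : R, 0 <= C & forall f, `|phi f| <= C * `|f|.
Proof.
have : bounded_near phi (nbhs (0 : V)).
  apply: (@continuous_linear_bounded R V R); exact: dual_continuous.
move/(@linear_boundedP R V R) => /pinfty_ex_gt0[C C0 Cphi].
by exists C; [exact: ltW | move=> f; exact: Cphi].
Qed.

Lemma dual_norm_le phi (C : R) : 0 <= C ->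
  (forall f, `|phi f| <= C * `|f|) -> dual_norm phi <= C.
Proof.
move=> C0 Cphi; apply: ge_sup; first by exists `|phi 0|, 0 => //=; rewrite normr0.
by move=> _ [f /= f1 <-]; rewrite (le_trans (Cphi f))// ler_piMr.
Qed.

Lemma dual_normP phi f : `|phi f| <= dual_norm phi * `|f|.
Proof.
have [->|f0] := eqVneq f 0; first by rewrite linear0 !normr0 mulr0.
rewrite -ler_pdivrMr ?normr_gt0//; apply: ub_le_sup.
  have [C C0 Cphi] := dual_bounded phi.
  exists C => _ [g /= g1 <-].
  by rewrite (le_trans (Cphi g))// ler_piMr.
exists (`|f|^-1 *: f) => /=.
  by rewrite normrZ normfV normr_id mulVf// normr_eq0.
by rewrite linearZ /= normrM normfV normr_id mulrC.
Qed.

Lemma dual_norm_ge0 phi : 0 <= dual_norm phi.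
Proof.
apply: (le_trans (normr_ge0 (phi 0))); apply: ub_le_sup; last first.
  by exists 0 => //=; rewrite normr0.
have [C C0 Cphi] := dual_bounded phi.
by exists C => _ [g /= g1 <-]; rewrite (le_trans (Cphi g))// ler_piMr.
Qed.

Lemma dual_normD phi psi :
  dual_norm (phi + psi) <= dual_norm phi + dual_norm psi.
Proof.
apply: dual_norm_le => [|f]; first by rewrite addr_ge0 ?dual_norm_ge0.
rewrite mulrDl /= fctE (le_trans (ler_normD _ _))// lerD//; exact: dual_normP.
Qed.

Lemma dual_normZ (l : R) phi : dual_norm (l *: phi) = `|l| * dual_norm phi.
Proof.
apply: seminorm_homog => [|{}l {}phi]; first exact: dual_norm_ge0.
apply: dual_norm_le => [|f]; first by rewrite mulr_ge0 ?dual_norm_ge0.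
by rewrite /= fctE normrM -mulrA ler_wpM2l// dual_normP.
Qed.

Lemma dual_norm_eq0 phi : dual_norm phi = 0 -> phi = 0.
Proof.
move=> phi0; apply/val_inj/funext => f /=.
by have := dual_normP phi f; rewrite phi0 mul0r normr_le0 => /eqP.
Qed.

HB.instance Definition _ :=
  @Lmodule_isNormed.Build R dual dual_norm dual_normD dual_normZ dual_norm_eq0.

End Dual.
Arguments dual_pred {R} V _.

Section Mulop.
Context {R : realType} {M : pointedMetricType R}.
Implicit Types (h : lip_bs M) (f : Lip0 M).

Lemma lip_bs_bounded h : exists2 C : R, 0 <= C & forall x, `|h x| <= C.
Proof.
have [L L0 Lh] := is_lipschitz_ge0 (lip_bs_lipschitz h).
have [c [r cr]] := lip_bs_support h.
exists (`|h c| + L * `|r|) => [|x]; first by rewrite addr_ge0// mulr_ge0.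
have [->|hx0] := eqVneq (h x) 0; first by rewrite normr0 addr_ge0// mulr_ge0.
rewrite -[h x](subrK (h c)) addrC (le_trans (ler_normD _ _))// lerD2l.
by rewrite (le_trans (Lh _ _))// ler_wpM2l// (le_trans (cr x hx0))// ler_norm.
Qed.

Lemma lip_bs_supp_point h :
  exists2 r : R, 0 <= r & forall x, h x != 0 -> mdist x point <= r.
Proof.
have [c [r cr]] := lip_bs_support h.
exists (`|r| + mdist c point) => [|x hx]; first by rewrite addr_ge0 ?mdist_ge0.
rewrite (le_trans (metric_triangle _ c _))// lerD2r.
by rewrite (le_trans (cr x hx))// ler_norm.
Qed.

Lemma mulop_bound h : exists2 C : R, 0 <= C & forall f x y,
  `|f x * h x - f y * h y| <= C * lip_norm f * mdist x y.
Proof.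
have [L L0 Lh] := is_lipschitz_ge0 (lip_bs_lipschitz h).
have [H H0 Hh] := lip_bs_bounded h.
have [r r0 hr] := lip_bs_supp_point h.
have C0 : 0 <= H + r * L by rewrite addr_ge0// mulr_ge0.
exists (H + r * L) => // f.
have f0 : 0 <= lip_norm f := lip_norm_ge0 f.
have key x y : h x != 0 ->
    `|f x * h x - f y * h y| <= (H + r * L) * lip_norm f * mdist x y.
  move=> hx0; have -> : f x * h x - f y * h y =
      h y * (f x - f y) + f x * (h x - h y) by ring.
  rewrite (le_trans (ler_normD _ _))// !normrM !mulrDl lerD//.
    by rewrite -mulrA ler_pM// lip_normP.
  have fx : `|f x| <= lip_norm f * r.
    have := lip_normP f x point; rewrite Lip0_point subr0 => /le_trans; apply.
    by rewrite ler_wpM2l// hr.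
  rewrite (le_trans (ler_pM _ _ fx (Lh x y)))//.
  by rewrite le_eqVlt; apply/orP; left; apply/eqP; ring.
move=> x y; have [hx|hx] := eqVneq (h x) 0; last exact: key.
have [hy|hy] := eqVneq (h y) 0.
  by rewrite hx hy !mulr0 subrr normr0 !mulr_ge0 ?mdist_ge0.
by rewrite distrC metric_sym key.
Qed.

Lemma mulop_subproof h f : (fun x => f x * h x) \in lip0_pred M.
Proof.
apply/asboolP; split; last by rewrite Lip0_point mul0r.
by have [C C0 Ch] := mulop_bound h; exists (C * lip_norm f); exact: Ch.
Qed.

(* The weighting operator T_h : f |-> f . h on Lip0 M, shown below to be linear
   and continuous; [comp_mulop phi h] is the functional phi \o T_h. *)
Definition mulop h f : Lip0 M := mkLip0 (mulop_subproof h f).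

Lemma mulop_linear h : linear (mulop h).
Proof.
move=> a f g; apply/val_inj/funext => x /=.
by rewrite !fctE /= /GRing.scale/=; ring.
Qed.

HB.instance Definition _ h :=
  GRing.isLinear.Build R (Lip0 M) (Lip0 M) *:%R (mulop h) (mulop_linear h).

Lemma mulop_continuous h : continuous (mulop h).
Proof.
apply: bounded_linear_continuous; apply/linear_boundedP.
have [C C0 Ch] := mulop_bound h; near=> K => f.
apply: (@le_trans _ _ (C * `|f|)).
  by apply: lip_norm_le => [|x y]; [rewrite mulr_ge0 | exact: Ch].
by rewrite ler_wpM2r//; near: K; exact: nbhs_pinfty_ge.
Unshelve. all: by end_near. Qed.

Lemma comp_mulop_subproof (phi : dual (Lip0 M)) h :
  phi \o mulop h \in dual_pred (Lip0 M).
Proof.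
apply/asboolP; split=> [a f g|f]; first by rewrite /= !linearP.
by apply: continuous_comp; [exact: mulop_continuous|exact: dual_continuous].
Qed.

Definition comp_mulop (phi : dual (Lip0 M)) h : dual (Lip0 M) :=
  mkDual (comp_mulop_subproof phi h).

End Mulop.

Section LambdaPi.
Context {R : realType} (M : pointedMetricType R).

Definition Lambda_fun (n : int) (x : M) : R :=
  let t := mdist x point in
  if t <= 2 ^ (n - 1) then 0
  else if t <= 2 ^ n then 2 ^ (- (n - 1)) * t - 1
  else if t <= 2 ^ (n + 1) then 2 - 2 ^ (- n) * t
  else 0.

Definition Pi_fun (n : nat) (x : M) : R :=
  let t := mdist x point in
  if t <= 2 ^- n.+1 then 0
  else if t <= 2 ^- n then 2 ^+ n.+1 * t - 1
  else if t <= 2 ^+ n then 1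
  else if t <= 2 ^+ n.+1 then 2 - 2 ^- n * t
  else 0.

Lemma dist_mdist (x y z : M) : `|mdist x z - mdist y z| <= mdist x y.
Proof.
rewrite ler_norml lerBrDr lerBlDr metric_triangle andbT addrC.
by rewrite lerBlDr addrC (metric_sym x y) metric_triangle.
Qed.

Lemma lipschitz_comp_dist (g : R -> R) (L : R) : 0 <= L ->
  (forall s t, s <= t -> `|g t - g s| <= L * (t - s)) ->
  is_lipschitz (fun x : M => g (mdist x point)).
Proof.
move=> L0 Lg; exists L => x y; rewrite (@le_trans _ _ (L *
  `|mdist x point - mdist y point|))//; last by rewrite ler_wpM2l// dist_mdist.
have [xy|/ltW xy] := leP (mdist y point) (mdist x point).
  by rewrite [X in _ * X]ger0_norm ?subr_ge0// Lg.
by rewrite distrC [X in _ * X]distrC [X in _ * X]ger0_norm ?subr_ge0// Lg.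
Qed.

Lemma Lambda_lipschitz n : is_lipschitz (Lambda_fun n).
Proof.
pose a : R := 2 ^ (- n); have a0 : 0 < a by rewrite exprz_gt0.
have aE : a * 2 ^ n = 1 by rewrite -expfzDr// addNr expr0z.
have E1 : 2 ^ (n - 1) = 2 ^ n / 2 :> R by rewrite expfzDr// exprN1.
have E2 : 2 ^ (n + 1) = 2 ^ n * 2 :> R by rewrite expfzDr// expr1z.
have E3 : 2 ^ (- (n - 1)) = a * 2 :> R.
  by rewrite opprB addrC expfzDr// expr1z.
apply: (@lipschitz_comp_dist (fun t => if t <= 2 ^ (n - 1) then 0
  else if t <= 2 ^ n then 2 ^ (- (n - 1)) * t - 1
  else if t <= 2 ^ (n + 1) then 2 - 2 ^ (- n) * t
  else 0) (a * 2)) => [|s t]; first by rewrite mulr_ge0// ltW.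
have le1 u : (u <= 2 ^ (n - 1)) = (a * u <= 1 / 2).
  by rewrite E1 -(ler_pM2l a0) mulrA aE.
have le2 u : (u <= 2 ^ n) = (a * u <= 1) by rewrite -(ler_pM2l a0) aE.
have le3 u : (u <= 2 ^ (n + 1)) = (a * u <= 2).
  by rewrite E2 -(ler_pM2l a0) mulrA aE mul1r.
rewrite -(ler_pM2l a0) !le1 !le2 !le3 E3 -/a.
have -> : a * 2 * (t - s) = 2 * (a * t - a * s) by ring.
have -> : a * 2 * t = 2 * (a * t) by ring.
have -> : a * 2 * s = 2 * (a * s) by ring.
move: (a * s) (a * t) => {}s {}t st; rewrite ler_norml.
by do ![case: ifPn; rewrite -?ltNge => ?]; apply/andP; split; lra.
Qed.

Lemma Lambda_support n : has_bounded_support (Lambda_fun n).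
Proof.
exists point, (2 ^ (n + 1)) => x; apply: contraNT; rewrite -ltNge => xn.
have le1 : (2 : R) ^ n <= 2 ^ (n + 1) by rewrite ler_weXz2l ?ler1n// lerDl.
have le2 : (2 : R) ^ (n - 1) <= 2 ^ n by rewrite ler_weXz2l ?ler1n// gerBl.
rewrite /Lambda_fun ![mdist x point <= _]leNgt xn.
by rewrite (le_lt_trans le1 xn) (le_lt_trans (le_trans le2 le1) xn).
Qed.

Lemma Pi_lipschitz n : is_lipschitz (Pi_fun n).
Proof.
pose b : R := 2 ^+ n; pose a : R := 2 ^- n.
have b1 : 1 <= b by rewrite exprn_ege1// ler1n.
have b0 : 0 < b by exact: lt_le_trans b1.
have a0 : 0 < a by rewrite invr_gt0.
have ab : a * b = 1 by rewrite mulVf// gt_eqF.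
have a1 : a <= 1 by rewrite invf_le1.
have E1 : 2 ^+ n.+1 = b * 2 :> R by rewrite exprSr.
have E2 : 2 ^- n.+1 = a / 2 :> R by rewrite E1 invfM.
apply: (@lipschitz_comp_dist (fun t => if t <= 2 ^- n.+1 then 0
  else if t <= 2 ^- n then 2 ^+ n.+1 * t - 1
  else if t <= 2 ^+ n then 1
  else if t <= 2 ^+ n.+1 then 2 - 2 ^- n * t
  else 0) (b * 2)) => [|s t st]; first by rewrite mulr_ge0// ltW.
have le1 u : (u <= 2 ^- n.+1) = (b * u <= 1 / 2).
  by rewrite E2 -(ler_pM2l b0) mulrA (mulrC b a) ab.
have le2 u : (u <= 2 ^- n) = (b * u <= 1).
  by rewrite -/a -(ler_pM2l b0) (mulrC b a) ab.
have le3 u : (u <= 2 ^+ n) = (a * u <= 1) by rewrite -/b -(ler_pM2l a0) ab.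
have le4 u : (u <= 2 ^+ n.+1) = (a * u <= 2).
  by rewrite E1 -(ler_pM2l a0) mulrA ab mul1r.
rewrite !le1 !le2 !le3 !le4 E1 -/a.
have -> : b * 2 * (t - s) = 2 * (b * t - b * s) by ring.
have -> : b * 2 * t = 2 * (b * t) by ring.
have -> : b * 2 * s = 2 * (b * s) by ring.
have h1 : a * s <= a * t by rewrite ler_pM2l.
have h2 : a * t - a * s <= b * t - b * s.
  by rewrite -!mulrBr ler_wpM2r ?subr_ge0// (le_trans a1).
have h3 u : b * u <= 1 -> a * u <= 1.
  move=> bu; rewrite -ab; have [u0|u0] := leP u 0.
    by rewrite ler_pM2l// (le_trans u0)// ltW.
  rewrite ler_pM2l// (le_trans _ b1)// (le_trans _ bu)//.
  by rewrite -[leLHS]mul1r ler_pM2r.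
move: (h3 s) (h3 t) h1 h2 => {h3}; clear le1 le2 le3 le4.
move: (a * s) (a * t) (b * s) (b * t) => p p' q q' hs ht h1 h2.
rewrite ler_norml.
have [qs|?] := leP q 1; have [qt|?] := leP q' 1;
  [move: (hs qs) (ht qt)|move: (hs qs)|move: (ht qt)|];
  do ![case: ifPn; rewrite -?ltNge => ?]; do ?move=> ?;
  apply/andP; split; lra.
Qed.

Lemma Pi_support n : has_bounded_support (Pi_fun n).
Proof.
exists point, (2 ^+ n.+1) => x; apply: contraNT; rewrite -ltNge => xn.
have n0 : 1 <= 2 ^+ n :> R by rewrite exprn_ege1// ler1n.
have n1 : (2 : R) ^+ n <= 2 ^+ n.+1 by rewrite ler_weXn2l// ler1n.
have n2 : (2 : R) ^- n <= 2 ^+ n by rewrite (le_trans _ n0)// invf_le1// exprn_gt0.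
have n3 : (2 : R) ^- n.+1 <= 2 ^+ n.
  by rewrite (le_trans _ n0)// invf_le1 ?exprn_gt0// (le_trans n0).
rewrite /Pi_fun ![mdist x point <= _]leNgt xn.
rewrite (le_lt_trans (le_trans n3 n1) xn) (le_lt_trans (le_trans n2 n1) xn).
by rewrite (le_lt_trans n1 xn).
Qed.

Definition Lambda (n : int) : lip_bs M :=
  LipBS (Lambda_lipschitz n) (Lambda_support n).

Definition Pi (n : nat) : lip_bs M := LipBS (Pi_lipschitz n) (Pi_support n).

End LambdaPi.

(* Main.v *)
(* Each operator T_{Lambda_n} has norm at most 5, and every point of M lies in
   the support of at most two of the Lambda_n, so a finite sum of functions
   T_{Lambda_n} f_n with f_n in the unit ball has norm at most 20. Testing phi
   on such a sum, with f_n almost norming phi \o T_{Lambda_n}, bounds the sum of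
   the norms of the phi \o T_{Lambda_n}. The partial sums of the Lambda_n
   telescope to Pi_n, so absolute convergence in the complete space Lip_0(M)^*
   gives the limit. *)
Require Import Defs.
From HB Require Import structures.
From mathcomp Require Import all_boot all_order all_algebra.
From mathcomp Require Import zify ring lra.
From mathcomp Require Import all_classical all_reals all_analysis.

Set Implicit Arguments.
Unset Strict Implicit.
Unset Printing Implicit Defensive.

Import Order.TTheory GRing.Theory Num.Theory.
Import numFieldNormedType.Exports.

Local Open Scope classical_set_scope.
Local Open Scope ring_scope.

(** * Symmetric sums over the integers and a counting bound *)

Definition sym_term (V : zmodType) (F : int -> V) (k : nat) : V :=
  if k is k'.+1 then F k%:Z + F (- k%:Z) else F 0.

(** Pairing k with -k turns the symmetric sums into partial sums of an ordinary series. Since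
    [series u n] stops before index n, the range from -n to n corresponds to [n.+1] terms. *)
Lemma sum_int_sym (V : zmodType) (F : int -> V) (n : nat) :
  \sum_(i < n.*2.+1) F (i%:Z - n%:Z) = series (sym_term F) n.+1.
Proof.
elim: n => [|n IH]; first by rewrite seriesEord /= !big_ord1 /= subrr.
rewrite doubleS big_ord_recr big_ord_recl /= sub0r.
rewrite [RHS]seriesSr -IH /= -addrA addrCA.
congr (_ + _).
  by apply: eq_bigr => i _ /=; congr (F _); rewrite /bump /=; lia.
by rewrite addrC; congr (F _ + _); rewrite /bump /=; lia.
Qed.

(** Using the hypothesis in both orders, any two members satisfying [p] differ by at most 1, which
    three distinct integers cannot do pairwise. *)
Lemma count_le2 (s : seq int) (p : pred int) : uniq s ->
  (forall m n, p m -> p n -> m <= n + 1) -> (count p s <= 2)%N.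
Proof.
move=> us p1; rewrite -size_filter.
have /allP := filter_all p s; move: (filter_uniq p us).
case: [seq n <- s | p n] => [|a [|b [|c t]]] //= uabc pabc.
have [pa pb pc] : [/\ p a, p b & p c].
  by split; apply: pabc; rewrite !inE eqxx ?orbT.
move: uabc; rewrite !inE !negb_or => /and4P[/and3P[ab ac _] /andP[bc _] _ _].
move: (p1 _ _ pa pb) (p1 _ _ pb pa) (p1 _ _ pa pc) (p1 _ _ pc pa)
  (p1 _ _ pb pc) (p1 _ _ pc pb).
by lia.
Qed.

(** * The bump profile at scale 1 *)

Section Hat.
Context {R : realType}.

(** The profile common to all [Lambda M n] once distances are rescaled by 2^(-n); estimates on it
    are uniform in n. *)
Definition hat (s : R) : R :=
  if s <= 1 / 2 then 0 else if s <= 1 then 2 * s - 1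
  else if s <= 2 then 2 - s else 0.

Lemma hat_ge0 s : 0 <= hat s.
Proof. by rewrite /hat; do ![case: ifPn; rewrite -?ltNge => ?]; lra. Qed.

Lemma hat_le1 s : hat s <= 1.
Proof. by rewrite /hat; do ![case: ifPn; rewrite -?ltNge => ?]; lra. Qed.

Lemma hat_neq0 s : hat s != 0 -> 1 / 2 < s < 2.
Proof.
rewrite /hat; do ![case: ifPn; rewrite -?ltNge => ?]; rewrite ?eqxx// => ?.
  by lra.
by apply/andP; split; lra.
Qed.

Lemma hat_lipschitz s t : `|hat s - hat t| <= 2 * `|s - t|.
Proof.
wlog st : s t / t <= s.
  by move=> H; have [/H//|/ltW/H] := leP t s; rewrite distrC (distrC t).
rewrite [X in _ * X]ger0_norm ?subr_ge0// ler_norml /hat.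
by do ![case: ifPn; rewrite -?ltNge => ?]; apply/andP; split; lra.
Qed.

End Hat.

(** * The weights: telescoping, operator norm and overlap *)

Section Weights.
Context {R : realType} {M : pointedMetricType R}.
Implicit Types (x y : M) (f : Lip0 M) (n : int).

Lemma LambdaE n x : Lambda M n x = hat (2 ^ (- n) * mdist x point).
Proof.
rewrite /= /Lambda_fun /hat; set t := mdist x point.
pose a : R := 2 ^ (- n); have a0 : 0 < a by rewrite exprz_gt0.
have aE : a * 2 ^ n = 1 by rewrite -expfzDr// addNr expr0z.
rewrite -!(ler_pM2l a0 t) expfzDr// expfzDr// exprN1 expr1z !mulrA aE.
by rewrite opprB expfzDr// expr1z -/a !mul1r.
Qed.

(** On [2^n, 2^(n+1)] the falling slope of Pi_n and the rising slope of Lambda_(n+1) add up to 1,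
    which extends the plateau outwards; Lambda_(-(n+1)) does the same towards the base point. *)
Lemma PiS (n : nat) x :
  Pi M n.+1 x = Pi M n x + (Lambda M n.+1 x + Lambda M (- n.+1%:Z) x).
Proof.
rewrite !LambdaE /= /Pi_fun /hat opprK; set t := mdist x point.
have t0 : 0 <= t by exact: mdist_ge0.
pose b : R := 2 ^+ n; pose a : R := 2 ^- n.
have b1 : 1 <= b by rewrite exprn_ege1// ler1n.
have b0 : 0 < b by exact: lt_le_trans b1.
have a0 : 0 < a by rewrite invr_gt0.
have ab : a * b = 1 by rewrite mulVf// gt_eqF.
have a1 : a <= 1 by rewrite invf_le1.
have -> : 2 ^ (- n.+1%:Z) = a / 2 :> R by rewrite -exprnN exprSr invfM mulrC.
have -> : 2 ^ n.+1%:Z = b * 2 :> R by rewrite -exprnP exprSr.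
rewrite !exprSr -/b !invfM -/a.
have ba u : (t <= a * u) = (b * t <= u).
  by rewrite -(ler_pM2l b0) mulrA (mulrC b a) ab mul1r.
have abu u : (t <= b * u) = (a * t <= u).
  by rewrite -(ler_pM2l a0) mulrA ab mul1r.
have qp : a * t <= b * t by rewrite ler_wpM2r// (le_trans a1).
have q1 : b * t <= 1 -> a * t <= 1.
  rewrite -{1}ba -abu mulr1 => ta.
  by rewrite mulr1 (le_trans ta)// (le_trans a1).
have -> : (t <= a) = (b * t <= 1) by rewrite -ba mulr1.
have -> : (t <= b) = (a * t <= 1) by rewrite -abu mulr1.
rewrite -!(mulrA a) -!(mulrA b) !ba !abu (mulrCA a) (mulrCA b) !(mulrCA b).
(* All thresholds are now conditions on q = 2^(-n) t and p = 2^n t, so only linear case analysis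
   remains. *)
clear ba abu; move: (a * t) (b * t) qp q1 => q p qp q1.
have -> : (2^-1 * q <= 1 / 2) = (q <= 1) by apply/idP/idP; lra.
have -> : (2^-1 * q <= 1) = (q <= 2) by apply/idP/idP; lra.
have -> : (2^-1 * q <= 2) = (q <= 2 * 2) by apply/idP/idP; lra.
have -> : (2 * p <= 1 / 2) = (p <= 2^-1 / 2) by apply/idP/idP; lra.
have -> : (2 * p <= 1) = (p <= 2^-1) by apply/idP/idP; lra.
have -> : (2 * p <= 2) = (p <= 1) by apply/idP/idP; lra.
have [p1|p1] := leP p 1.
  have {q1}qle1 := q1 p1; have -> : q <= 2 by lra.
  rewrite qle1.
  by have [?|?] := leP p (2^-1 / 2); have [?|?] := leP p (2^-1); lra.
clear q1.
have -> : (p <= 2^-1 / 2) = false by apply/negbTE; rewrite -ltNge; lra.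
have -> : (p <= 2^-1) = false by apply/negbTE; rewrite -ltNge; lra.
by have [?|?] := leP q 1; have [?|?] := leP q 2;
  have [?|?] := leP q (2 * 2); lra.
Qed.

(** Product rule: 5 = 1 + 2 * 2, with 1 from the bound on [hat], one 2 from its Lipschitz constant
    and the other from 2^(-n) d(x,0) < 2 on the support. *)
Lemma le_lip_norm_mulop_Lambda n f :
  lip_norm (mulop (Lambda M n) f) <= 5 * lip_norm f.
Proof.
pose a : R := 2 ^ (- n); have a0 : 0 < a by rewrite exprz_gt0.
have f0 := lip_norm_ge0 f.
have TE z : mulop (Lambda M n) f z = f z * Lambda M n z by [].
apply: lip_norm_le => [|x y]; first by rewrite mulr_ge0.
(* The factor [f x] of the second term below is controlled only when x lies in the support. *)
wlog hx : x y / Lambda M n x != 0 => [H|].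
  have [hx|hx] := eqVneq (Lambda M n x) 0; last exact: H.
  have [hy|hy] := eqVneq (Lambda M n y) 0; last first.
    by rewrite distrC metric_sym H.
  by rewrite !TE hx hy !mulr0 subrr normr0 !mulr_ge0 ?mdist_ge0.
have d0 := mdist_ge0 x y.
have -> : mulop (Lambda M n) f x - mulop (Lambda M n) f y =
    Lambda M n y * (f x - f y) + f x * (Lambda M n x - Lambda M n y).
  by rewrite !TE; ring.
rewrite (le_trans (ler_normD _ _))// !normrM.
have -> : 5 * lip_norm f * mdist x y =
  1 * (lip_norm f * mdist x y) + lip_norm f * (4 * mdist x y) by ring.
apply: lerD.
  by rewrite ler_pM// ?lip_normP// LambdaE ger0_norm ?hat_ge0 ?hat_le1.
have fx : `|f x| <= lip_norm f * mdist x point.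
  by have := lip_normP f x point; rewrite Lip0_point subr0.
rewrite (le_trans (ler_wpM2r (normr_ge0 _) fx))// -mulrA ler_wpM2l//.
rewrite !LambdaE in hx *.
have /andP[_ ax2] := hat_neq0 hx.
rewrite (le_trans (ler_wpM2l (mdist_ge0 _ _) (hat_lipschitz _ _)))//.
rewrite -mulrBr normrM (gtr0_norm a0) mulrCA.
have := dist_mdist x y point; rewrite -/a in ax2 *.
move: `|_ - _| (normr_ge0 (mdist x point - mdist y point)) => e e0 ed.
have -> : 2 * (mdist x point * (a * e)) = 2 * (a * mdist x point) * e by ring.
by rewrite ler_pM ?mulr_ge0 ?mdist_ge0 ?(ltW a0)//; lra.
Qed.

(** A nonzero value forces 2^(n-1) < d(x,0) < 2^(n+1); these intervals are disjoint for indices at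
    least two apart. *)
Lemma count_Lambda (s : seq int) x : uniq s ->
  (count (fun n => Lambda M n x != 0%R) s <= 2)%N.
Proof.
move=> us; apply: count_le2 => // m n; rewrite !LambdaE.
move=> /hat_neq0/andP[m1 _] /hat_neq0/andP[_ n2].
rewrite leNgt; apply/negP => mn.
have pow4 : 4 <= 2 ^ (m - n) :> R.
  have -> : 4 = 2 ^ 2 :> R by rewrite -exprnP; ring.
  by rewrite ler_weXz2l ?ler1n//; lia.
suff : 2 < 2 ^ (- n) * mdist x point by rewrite ltNge (ltW n2).
have -> : - n = (m - n) + (- m) by lia.
rewrite expfzDr// -mulrA.
move: (2 ^ (m - n)) (2 ^ (- m) * _) pow4 m1 => u v u4 v2; nra.
Qed.

Lemma Lip0_sumE (I : Type) (s : seq I) (F : I -> Lip0 M) x :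
  (\sum_(i <- s) F i) x = \sum_(i <- s) F i x.
Proof. by elim/big_rec2: _ => // i y z _ <-. Qed.

(* 20 = 4 * 5: at most four summands do not vanish at both x and y. *)
Lemma lip_norm_sum_mulop_Lambda (s : seq int) (F : int -> Lip0 M) : uniq s ->
  (forall n, lip_norm (F n) <= 1) ->
  lip_norm (\sum_(n <- s) mulop (Lambda M n) (F n)) <= 20.
Proof.
move=> us F1; apply: lip_norm_le => // x y; have d0 := mdist_ge0 x y.
pose p z n := Lambda M n z != 0.
have countE z : (\sum_(n <- s) p z n = count (p z) s)%N.
  rewrite -sum1_count [RHS]big_mkcond; apply: eq_bigr => n _.
  by case: (p z n).
rewrite !Lip0_sumE -sumrB (le_trans (ler_norm_sum _ _ _))//.
apply: (@le_trans _ _ (\sum_(n <- s) 5 * mdist x y * (p x n + p y n)%:R)).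
  apply: ler_sum => n _; have [|p0] := eqVneq (p x n + p y n)%N 0%N.
    move=> /eqP; rewrite addn_eq0 !eqb0 => /andP[/negPn/eqP hx /negPn/eqP hy].
    rewrite -[mulop _ _ x]/(_ * _) -[mulop _ _ y]/(_ * _) hx hy !mulr0.
    by rewrite subrr normr0 !mulr_ge0.
  have p1 : 1 <= (p x n + p y n)%:R :> R by rewrite ler1n lt0n.
  rewrite (le_trans (lip_normP _ _ _))// -[leLHS]mulr1 ler_pM ?mulr_ge0//.
    exact: lip_norm_ge0.
  rewrite ler_wpM2r// (le_trans (le_lip_norm_mulop_Lambda _ _))//.
  by rewrite ler_piMr.
rewrite -mulr_sumr -natr_sum big_split !countE /=.
have k4 : (count (p x) s + count (p y) s)%:R <= 4 :> R.
  by rewrite ler_nat -[4%N]/(2 + 2)%N leq_add// count_Lambda.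
by nra.
Qed.

End Weights.

(** * Almost norming vectors and completeness of the dual *)

Section Dual.
Context {R : realType} {V : normedModType R}.
Implicit Types phi psi : dual V.

Lemma dual_sumE (I : Type) (s : seq I) (F : I -> dual V) f :
  (\sum_(i <- s) F i) f = \sum_(i <- s) F i f.
Proof. by elim/big_rec2: _ => // i y z _ <-. Qed.

Lemma dual_dist_le phi psi f : `|phi f - psi f| <= `|phi - psi| * `|f|.
Proof. exact: (dual_normP (phi - psi) f). Qed.

Lemma dual_norming phi (c : R) : c < 1 ->
  exists2 f, `|f| <= 1 & c * `|phi| <= phi f.
Proof.
move=> c1; apply: contrapT => H.
have {}H f : `|f| <= 1 -> phi f < c * `|phi|.
  by move=> f1; rewrite ltNge; apply/negP => cf; apply: H; exists f.
(* Testing at 0 excludes the zero functional. *)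
have := H 0; rewrite normr0 linear0 => /(_ ler01) c0.
have N0 : 0 < `|phi|.
  rewrite lt0r normr_ge0 andbT; apply: contraTneq c0 => ->.
  by rewrite mulr0 ltxx.
suff : `|phi| <= c * `|phi| by apply/negP; rewrite -ltNge gtr_pMl.
apply: ge_sup; first by exists `|phi 0|, 0 => //=; rewrite normr0.
(* Since -f is also in the unit ball, the one-sided bound controls the absolute value. *)
move=> _ [f /= f1 <-]; rewrite ler_norml lerNl -linearN/=.
by rewrite !ltW ?H// normrN.
Qed.

(** The limit is taken pointwise; the uniform estimate [psi_near] then gives both its continuity and
    convergence in norm. *)
Lemma dual_complete (F : set_system (dual V)) :
  ProperFilter F -> cauchy F -> cvg F.
Proof.
move=> FF Fc.
have ev_cvg f : cvg ((fun u : dual V => u f) @ F).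
  apply: cauchy_cvg; apply/cauchyP => e e0.
  (* Dividing by [|f| + 1] covers f = 0 as well. *)
  have f1 : 0 < `|f| + 1 by rewrite ltr_wpDl.
  have [u Fu] := (cauchyP F).1 Fc _ (divr_gt0 e0 f1).
  exists (u f); change (F [set v : dual V | ball (u f) e (v f)]).
  apply: filterS Fu => v; rewrite -!ball_normE /= => uv.
  apply: (le_lt_trans (dual_dist_le u v f)).
  apply: (@le_lt_trans _ _ (`|u - v| * (`|f| + 1))); last first.
    by rewrite -ltr_pdivlMr.
  by rewrite ler_wpM2l// lerDl.
pose psi f := lim ((fun u : dual V => u f) @ F).
have psi_near (u : dual V) e f : F (ball u e) -> `|psi f - u f| <= e * `|f|.
  move=> Fu; apply: (cvgr_to_le (F := F) (f := fun v : dual V => `|v f - u f|)).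
    by apply: cvg_norm; apply: cvgB; [exact: ev_cvg|exact: cvg_cst].
  apply: filterS Fu => v; rewrite -ball_normE /= => uv.
  rewrite distrC; apply: (le_trans (dual_dist_le u v f)).
  by rewrite ler_wpM2r// ltW.
have psi_lin : scalar psi.
  move=> a f g; apply: cvg_lim; first exact: norm_hausdorff.
  under eq_fun do rewrite linearP.
  apply: cvgD; last exact: ev_cvg.
  by apply: cvgM; [exact: cvg_cst|exact: ev_cvg].
pose psiL : {scalar V} :=
  HB.pack psi (GRing.isLinear.Build R V R *%R psi psi_lin).
have psi_cont : continuous psi.
  apply: (@bounded_linear_continuous R V R psiL); apply/linear_boundedP.
  have [u Fu] := (cauchyP F).1 Fc _ ltr01.
  near=> K => f; have -> : psiL f = (psi f - u f) + u f by rewrite subrK.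
  rewrite (le_trans (ler_normD _ _))//.
  apply: (@le_trans _ _ ((1 + `|u|) * `|f|)).
    by rewrite mulrDl lerD ?psi_near//; exact: dual_normP.
  by rewrite ler_wpM2r//; near: K; exact: nbhs_pinfty_ge.
have psiP : psi \in dual_pred V by apply/asboolP.
apply: (@cvgP _ _ (mkDual psiP)); apply/cvgrPdist_le => e e0.
have e2 : 0 < e / 2 by rewrite divr_gt0.
have [u Fu] := (cauchyP F).1 Fc _ e2.
apply: filterS (Fu) => v; rewrite -ball_normE /= => uv.
apply: dual_norm_le => [|f]; first exact: ltW.
rewrite -[(_ - _ : dual V) f]/(psi f - v f).
have -> : psi f - v f = (psi f - u f) + (u f - v f) by ring.
rewrite (le_trans (ler_normD _ _))// [e]splitr mulrDl lerD ?psi_near//.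
apply: (le_trans (dual_dist_le u v f)).
by rewrite ler_wpM2r// ltW.
Unshelve. all: by end_near. Qed.

HB.instance Definition _ := Uniform_isComplete.Build (dual V) dual_complete.

End Dual.

(** * Summability and convergence *)

Section Main.
Context {R : realType} {M : pointedMetricType R}.
Implicit Types phi : dual (Lip0 M).

(** Duplicate-free lists cover both the finite subsets of the integers and the symmetric ranges. *)
Lemma sum_norm_comp_mulop_Lambda phi (s : seq int) : uniq s ->
  \sum_(n <- s) `|comp_mulop phi (Lambda M n)| <= 45 * `|phi|.
Proof.
(* 4 / 9 is the ratio of the bound 20 above to the constant 45 *)
move=> us; have c1 : 4 / 9 < 1 :> R by lra.
have /choice[F FP] n : exists f, `|f| <= 1 /\
    4 / 9 * `|comp_mulop phi (Lambda M n)| <= phi (mulop (Lambda M n) f).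
  have [f f1 phif] := dual_norming (comp_mulop phi (Lambda M n)) c1.
  by exists f.
suff : 4 / 9 * \sum_(n <- s) `|comp_mulop phi (Lambda M n)| <= `|phi| * 20.
  by lra.
rewrite mulr_sumr.
apply: (@le_trans _ _ (\sum_(n <- s) phi (mulop (Lambda M n) (F n)))).
  by apply: ler_sum => n _; have [] := FP n.
rewrite -linear_sum (le_trans (ler_norm _))// (le_trans (dual_normP _ _))//.
rewrite ler_wpM2l ?dual_norm_ge0// lip_norm_sum_mulop_Lambda// => n.
by have [] := FP n.
Qed.

Lemma uniq_int_sym (n : nat) : uniq [seq i%:Z - n%:Z | i <- iota 0 n.*2.+1].
Proof. by rewrite map_inj_uniq ?iota_uniq// => i j /addIr []. Qed.

Lemma sum_Lambda (n : nat) (x : M) :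
  \sum_(i < n.*2.+1) Lambda M (i%:Z - n%:Z) x = Pi M n x.
Proof.
rewrite (sum_int_sym (fun k => Lambda M k x)).
elim: n => [|n IH]; last by rewrite seriesSr IH -PiS.
(* The plateau of Pi_0 shrinks to d(x,0) = 1, so Pi_0 is Lambda_0. *)
rewrite seriesEord /= big_ord1 [LHS]LambdaE oppr0 expr0z mul1r /hat /Pi_fun.
by rewrite !expr1 !expr0 invr1 div1r mul1r; case: (leP _ 1).
Qed.

Lemma sum_comp_mulop_Lambda phi (n : nat) :
  \sum_(i < n.*2.+1) comp_mulop phi (Lambda M (i%:Z - n%:Z)) =
  comp_mulop phi (Pi M n).
Proof.
apply/val_inj/funext => f; rewrite [LHS]dual_sumE -linear_sum.
congr (phi _); apply/val_inj/funext => x; rewrite [LHS]Lip0_sumE.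
by rewrite -[RHS]/(f x * Pi M n x) -sum_Lambda mulr_sumr.
Qed.

Lemma is_cvg_comp_mulop_Pi phi : cvgn (fun n => comp_mulop phi (Pi M n)).
Proof.
pose G k := comp_mulop phi (Lambda M k).
have : cvgn (series (sym_term G)).
  apply: normed_cvg; apply: nondecreasing_is_cvgn.
    by apply: nondecreasing_series => *; exact: normr_ge0.
  exists (45 * `|phi|) => _ [n _ <-].
  (* The extra term is nonnegative; it makes the sum a full symmetric range, to which the finite
     bound applies. *)
  apply: (@le_trans _ _ (series (sym_term (fun k => `|G k|)) n.+1)).
    rewrite /= /series /= big_nat_recr//= -[leLHS]addr0 lerD//.
      by apply: ler_sum => -[//|k] _; exact: ler_normD.
    by case: n => //= n; rewrite addr_ge0.
  rewrite -sum_int_sym.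
  have := sum_norm_comp_mulop_Lambda phi (uniq_int_sym n).
  by rewrite big_map -[iota _ _]/(index_iota 0 n.*2.+1) big_mkord.
have -> : (fun n => comp_mulop phi (Pi M n)) =
    [sequence series (sym_term G) n.+1]_n.
  by apply/funext => n; rewrite -sum_comp_mulop_Lambda (sum_int_sym G).
by move=> Gcvg; apply: cvgP; rewrite cvg_shiftS; exact: Gcvg.
Qed.

End Main.

Theorem lemma3 (R : realType) (M : completePointedMetricType R)
    (phi : dual (Lip0 M)) :
  [/\ (\esum_(n in [set: int]) (`|comp_mulop phi (Lambda M n)|)%:E
        <= (45 * `|phi|)%:E)%E,
      forall n : nat,
        \sum_(i < n.*2.+1) comp_mulop phi (Lambda M (i%:Z - n%:Z))
        = comp_mulop phi (Pi M n)
    & exists psi : dual (Lip0 M),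
        (fun n : nat => comp_mulop phi (Pi M n)) @ \oo --> psi].
Proof.
split; last 2 first.
- exact: sum_comp_mulop_Lambda.
- by eexists; exact: is_cvg_comp_mulop_Pi.
(* The sum over the integers is the supremum of its finite subsums, each already bounded. *)
apply: ge_ereal_sup => _ [A [finA _] <-].
rewrite fsumEFin// lee_fin fsbig_finite//.
by apply: sum_norm_comp_mulop_Lambda; exact: finmap.fset_uniq.
Qed.
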